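(* Let $T>0$, $g\in\mathbb{R}^3$, and let $(\eta,\sigma)$, with $\eta(t,s)\in\mathbb{R}^3$ and $\sigma(t,s)\in\mathbb{R}$, be a regular solution of $$\eta_{tt}=(\sigma\eta_s)_s+g,\qquad |\eta_s|=1,\qquad t\in[0,T],\ s\in[0,1],$$ with initial conditions $\eta(0,s)=\alpha(s)$, $\eta_t(0,s)=\beta(s)$, and with one of the following boundary conditions (for all $t\in[0,T]$): (a) two fixed ends: $\eta(t,0)=\alpha(0)$ and $\eta(t,1)=\alpha(1)$; (b) two free ends: $\sigma(t,0)=\sigma(t,1)=0$; (c) periodic: $\eta$ and $\sigma$ are defined for $s\in\mathbb{R}$ (and solve the system there), $\eta(t,s)=\eta(t,s+1)$ and $\sigma(t,s)=\sigma(t,s+1)$; (d) whip: $\sigma(t,0)=0$ and $\eta(t,1)=0$. Assume that one of the following holds: (i) the boundary condition is (b) or (c); (ii) the boundary condition is (d) and $g=0$; (iii) the boundary condition is (a), $|\alpha(0)-\alpha(1)|<1$ and $g=0$. Then $\sigma\ge0$ for all times, i.e. $\sigma(t,s)\ge 0$ for all $t\in[0,T]$ and all $s$.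
   Context: Subscripts $s,t$ denote partial derivatives and $|\cdot|$ is the Euclidean norm on $\mathbb{R}^3$. ''Regular solution'' means a classical solution (up to the boundary of the domain) that is sufficiently smooth, so that all derivatives involved in the associated arguments are continuous; here these are $\eta_t,\eta_s,\eta_{ss},\eta_{st},\eta_{tt},\eta_{stt},\sigma_s,\sigma_{ss}$. *)

(* Defs.v *)
From HB Require Import structures.
From mathcomp Require Import all_boot all_order all_algebra.
From mathcomp Require Import all_classical all_reals all_analysis.
Set Implicit Arguments.
Unset Strict Implicit.
Unset Printing Implicit Defensive.
Import Order.TTheory GRing.Theory Num.Theory.
Import numFieldNormedType.Exports.
Local Open Scope classical_set_scope.
Local Open Scope ring_scope.

(* The norm that the library puts on ['rV[R]_3] is the max norm; it defines the
   same topology, but the constraint |eta_s| = 1 needs the Euclidean one. *)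
Definition enorm (R : realType) (u : 'rV[R]_3) : R :=
  Num.sqrt (\sum_(i < 3) u 0 i ^+ 2).

(* The library derivatives are two-sided. Here the difference quotient only
   sees points of the domain [D], so the derivative is one-sided at an endpoint
   of an interval, two-sided in the interior, and values outside [D] are
   irrelevant. As for the library's derivatives, [derive_within] is meaningful
   only under [derivable_within]. *)
Definition derivable_within (R : realType) (V : normedModType R) (D : set R)
    (f : R -> V) (x : R) : Prop :=
  cvg ((fun y => (y - x)^-1 *: (f y - f x)) @ within D x^').

Definition derive_within (R : realType) (V : normedModType R) (D : set R)
    (f : R -> V) (x : R) : V :=
  lim ((fun y => (y - x)^-1 *: (f y - f x)) @ within D x^').

(* Partial derivatives of a function of (t, s), in this argument order. *)
Definition pt (R : realType) (V : normedModType R) (I : set R)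
    (f : R -> R -> V) : R -> R -> V :=
  fun t s => derive_within I (fun t' => f t' s) t.

Definition ps (R : realType) (V : normedModType R) (J : set R)
    (f : R -> R -> V) : R -> R -> V :=
  fun t s => derive_within J (fun s' => f t s') s.

Definition has_cont_pt (R : realType) (V : normedModType R) (I J : set R)
    (f : R -> R -> V) : Prop :=
  (forall t s, I t -> J s -> derivable_within I (fun t' => f t' s) t) /\
  {within I `*` J, continuous (fun p : R * R => pt I f p.1 p.2)}.

Definition has_cont_ps (R : realType) (V : normedModType R) (I J : set R)
    (f : R -> R -> V) : Prop :=
  (forall t s, I t -> J s -> derivable_within J (fun s' => f t s') s) /\
  {within I `*` J, continuous (fun p : R * R => ps J f p.1 p.2)}.

(* Existence and continuity, up to the boundary of [I `*` J], of eta_t, eta_s,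
   eta_ss, eta_st, eta_tt, eta_stt, sigma_s, sigma_ss. Subscripts are read from
   left to right: eta_st is the t-derivative of eta_s. *)
Definition regular (R : realType) (I J : set R) (eta : R -> R -> 'rV[R]_3)
    (sigma : R -> R -> R) : Prop :=
  [/\ has_cont_pt I J eta, has_cont_ps I J eta,
      has_cont_ps I J (ps J eta) & has_cont_pt I J (ps J eta)] /\
  [/\ has_cont_pt I J (pt I eta),
      has_cont_pt I J (pt I (ps J eta)),
      has_cont_ps I J (sigma : R -> R -> R^o) &
      has_cont_ps I J (ps J (sigma : R -> R -> R^o))].

Inductive boundary_type := FixedEnds | FreeEnds | Periodic | Whip.

Definition s_domain (R : realType) (b : boundary_type) : set R :=
  match b with
  | Periodic => setT
  | _ => `[0, 1]
  end.

Definition boundary_condition (R : realType) (b : boundary_type) (I : set R)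
    (alpha : R -> 'rV[R]_3) (eta : R -> R -> 'rV[R]_3) (sigma : R -> R -> R) :
    Prop :=
  match b with
  | FixedEnds => forall t, I t -> eta t 0 = alpha 0 /\ eta t 1 = alpha 1
  | FreeEnds => forall t, I t -> sigma t 0 = 0 /\ sigma t 1 = 0
  | Periodic => forall t s, I t ->
      eta t s = eta t (s + 1) /\ sigma t s = sigma t (s + 1)
  | Whip => forall t, I t -> sigma t 0 = 0 /\ eta t 1 = 0
  end.

Definition string_equations (R : realType) (I J : set R) (g : 'rV[R]_3)
    (eta : R -> R -> 'rV[R]_3) (sigma : R -> R -> R) : Prop :=
  forall t s, I t -> J s ->
    pt I (pt I eta) t s =
      ps J (fun t' s' => sigma t' s' *: ps J eta t' s') t s + g /\
    enorm (ps J eta t s) = 1.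

Definition initial_conditions (R : realType) (I J : set R)
    (alpha beta : R -> 'rV[R]_3) (eta : R -> R -> 'rV[R]_3) : Prop :=
  forall s, J s -> eta 0 s = alpha s /\ pt I eta 0 s = beta s.

(* Main.v *)
Require Import Defs.
From HB Require Import structures.
From mathcomp Require Import all_boot all_order all_algebra.
From mathcomp Require Import all_classical all_reals all_analysis.
Import Order.TTheory GRing.Theory Num.Theory.
Import numFieldNormedType.Exports.
Local Open Scope classical_set_scope.
Local Open Scope ring_scope.

(** The tension solves, at each fixed time, a linear elliptic equation in [s].
Differentiating [|eta_s|^2 = 1] gives
[eta_s . eta_ss = 0] and [eta_stt . eta_s = - |eta_st|^2], so the tangential
part of the equation of motion is [eta_tt . eta_s = sigma_s + g . eta_s].
Differentiating this once more in [s], with [(eta_tt)_s = eta_stt], yields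
[sigma_ss = |eta_ss|^2 sigma - |eta_st|^2] ([tension_equation]). The gravity
terms cancel, and [eta_sss] never appears because the scalar product with
[eta_s] is taken before differentiating. The exchange [(eta_tt)_s = eta_stt] is two applications of
[mixed_partials_swap].

Hence [sigma] is concave wherever it is negative. A function with this property
which at each end of an interval either is nonnegative or has an outward
derivative that is nonnegative can only be nonnegative, or else negative
with vanishing derivative on the whole interval
([nonneg_or_negative_constant]). In the second case the tension equation reads
[0 = |eta_ss|^2 sigma - |eta_st|^2] with [sigma < 0], which forces
[eta_ss = 0]: the string is a straight segment ([nonneg_or_straight]).

The boundary conditions supply the endpoint information. At a free end
[sigma = 0]. At a fixed end [eta_tt = 0], so without gravity
[sigma_s = 0] by the tangential equation. A periodic string is cut at a minimum
of [sigma], where [sigma_s = 0]. A straight string of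
length one is then impossible: for free ends and for the whip [sigma] vanishes
at an end, for a periodic string the displacement over one period is zero, and
for two fixed ends it is shorter than one. *)

(** * Derivatives relative to a subset of the line *)

Set Implicit Arguments.
Unset Strict Implicit.
Unset Printing Implicit Defensive.

(** The relational form of the derivative: it can be transported to subsets and
combined without first proving that the limit is unique. *)
Definition has_deriv_within (R : realType) (V : normedModType R) (D : set R)
    (f : R -> V) (x : R) (l : V) : Prop :=
  (fun y => (y - x)^-1 *: (f y - f x)) @ within D x^' --> l.

Section WithinDerivative.
Variable R : realType.
Implicit Types (D E : set R) (x y : R).

Lemma near_withinNx D x : \forall y \near within D x^', D y /\ y != x.
Proof.
rewrite near_withinE; near=> y => Dy; split=> //.
by near: y; exact: nbhs_dnbhs_neq.
Unshelve. all: by end_near. Qed.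

Lemma has_deriv_within_cvg (V : normedModType R) D (f : R -> V) x l :
  has_deriv_within D f x l -> f y @[y --> within D x^'] --> f x.
Proof.
move=> fl.
have yx : (y - x) @[y --> within D x^'] --> (0 : R).
  have yx : y @[y --> within D x^'] --> x.
    by move=> A Ax; apply: (filterS _ (Ax : nbhs x A)).
  by rewrite -[X in _ --> X](subrr x); apply: cvgB yx _; exact: cvg_cst.
have : f x + (y - x) *: ((y - x)^-1 *: (f y - f x)) @[y --> within D x^']
    --> f x + 0 *: l.
  by apply: cvgD; [exact: cvg_cst | exact: cvgZ].
rewrite scale0r addr0; apply: cvg_trans; apply: near_eq_cvg.
near=> y; have [_ yNx] : D y /\ y != x by near: y; exact: near_withinNx.
by rewrite /= scalerA mulfV ?subr_eq0// scale1r addrC subrK.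
Unshelve. all: by end_near. Qed.

Lemma has_deriv_within_cts (V : normedModType R) D (f : R -> V) x l :
  has_deriv_within D f x l -> f y @[y --> within D (nbhs x)] --> f x.
Proof.
move=> /has_deriv_within_cvg fx A Afx.
apply: (filterS _ (fx A Afx : nbhs x _)) => y /= H Dy.
have [->|yNx] := eqVneq y x; first exact: nbhs_singleton Afx.
exact: H.
Qed.

Lemma has_deriv_withinS (V : normedModType R) D E (f : R -> V) x l :
  D `<=` E -> has_deriv_within E f x l -> has_deriv_within D f x l.
Proof. by move=> DE; apply: cvg_trans; apply: cvg_app; exact: within_subset. Qed.

Lemma eq_has_deriv_within (V : normedModType R) D (f g : R -> V) x l :
  (forall y, D y -> f y = g y) -> D x ->
  has_deriv_within D f x l -> has_deriv_within D g x l.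
Proof.
move=> fg Dx; apply: cvg_trans; apply: near_eq_cvg.
near=> y; have [Dy _] : D y /\ y != x by near: y; exact: near_withinNx.
by rewrite /= !fg.
Unshelve. all: by end_near. Qed.

(** Any two points of an interval are joined inside it, so each of them is an
accumulation point; this is what makes derivatives within [D] unique, even at
an endpoint of [D]. *)
Lemma within_dnbhs_proper D x y : is_interval D -> D x -> D y -> y != x ->
  ProperFilter (within D x^').
Proof.
move=> iD Dx Dy yNx; apply: Build_ProperFilter_ex.
move=> P; rewrite /within/= /dnbhs/within /= => -[e /= e0 He].
(* a fraction of the segment from x to y, small enough to stay within e of x *)
pose d := Num.min (e / 2) `|y - x| / `|y - x|.
have n0 : 0 < `|y - x| by rewrite normr_gt0 subr_eq0.
have d0 : 0 < d by rewrite divr_gt0// lt_min n0 divr_gt0.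
have d1 : d <= 1 by rewrite ler_pdivrMr// mul1r ge_min lexx orbT.
have dn : d * `|y - x| < e.
  rewrite /d mulfVK ?gt_eqF// gt_min; apply/orP; left.
  by rewrite ltr_pdivrMr// ltr_pMr// ltr1n.
exists (x + d * (y - x)); apply: He.
- by rewrite /ball/= opprD addrA subrr sub0r normrN normrM gtr0_norm.
- by rewrite -subr_eq0 addrAC subrr add0r mulf_eq0 negb_or gt_eqF// subr_eq0.
- have [xy|yx] := leP x y.
  + apply: (iD x y) => //; apply/andP; split.
      by rewrite lerDl mulr_ge0 ?subr_ge0// ltW.
    by rewrite -lerBrDl ler_piMl ?subr_ge0.
  + apply: (iD y x) => //; apply/andP; split.
      by rewrite -lerBlDl ler_niMl ?subr_le0// ltW.
    by rewrite gerDl mulr_ge0_le0 ?subr_le0// ltW.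
Qed.

Lemma has_deriv_within_unique (V : normedModType R) D (f : R -> V) x y l l' :
  is_interval D -> D x -> D y -> y != x ->
  has_deriv_within D f x l -> has_deriv_within D f x l' -> l = l'.
Proof.
move=> iD Dx Dy yNx fl fl'; have PF := within_dnbhs_proper iD Dx Dy yNx.
exact: (cvg_unique (@norm_hausdorff _ V)) fl fl'.
Qed.

Lemma has_deriv_withinE (V : normedModType R) D (f : R -> V) x y l :
  is_interval D -> D x -> D y -> y != x ->
  has_deriv_within D f x l -> derive_within D f x = l.
Proof.
move=> iD Dx Dy yNx fl; have PF := within_dnbhs_proper iD Dx Dy yNx.
exact/cvg_lim.
Qed.

Lemma has_deriv_within_cst (V : normedModType R) D (k : V) x :
  has_deriv_within D (fun=> k) x 0.
Proof.
rewrite /has_deriv_within; under eq_fun do rewrite subrr scaler0.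
exact: cvg_cst.
Qed.

Lemma has_deriv_withinD (V : normedModType R) D (f g : R -> V) x l m :
  has_deriv_within D f x l -> has_deriv_within D g x m ->
  has_deriv_within D (fun y => f y + g y) x (l + m).
Proof.
move=> fl gm; rewrite /has_deriv_within.
under eq_fun do rewrite opprD addrACA scalerDr.
exact: cvgD.
Qed.

Lemma has_deriv_withinB (V : normedModType R) D (f g : R -> V) x l m :
  has_deriv_within D f x l -> has_deriv_within D g x m ->
  has_deriv_within D (fun y => f y - g y) x (l - m).
Proof.
move=> fl gm; rewrite /has_deriv_within.
under eq_fun do rewrite opprD addrACA -opprD scalerBr.
exact: cvgB.
Qed.

Lemma has_deriv_within_sum (V : normedModType R) D (K : Type)
    (r : seq K) (f : K -> R -> V) x (l : K -> V) :
  (forall k, has_deriv_within D (f k) x (l k)) ->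
  has_deriv_within D (fun y => \sum_(k <- r) f k y) x (\sum_(k <- r) l k).
Proof.
move=> fl; elim: r => [|k r IHr].
  by rewrite big_nil; under eq_fun do rewrite big_nil; exact: has_deriv_within_cst.
by rewrite big_cons; under eq_fun do rewrite big_cons; exact: has_deriv_withinD.
Qed.

Lemma has_deriv_withinZ (V : normedModType R) D (k : R -> R) (f : R -> V) x m l :
  has_deriv_within D (k : R -> R^o) x m -> has_deriv_within D f x l ->
  has_deriv_within D (fun y => k y *: f y) x (m *: f x + k x *: l).
Proof.
move=> km fl; have fx := has_deriv_within_cvg fl.
rewrite /has_deriv_within.
have -> : (fun y => (y - x)^-1 *: (k y *: f y - k x *: f x)) =
  (fun y => ((y - x)^-1 *: (k y - k x : R^o)) *: f y +
            k x *: ((y - x)^-1 *: (f y - f x))).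
  apply/funext => y; set a := (y - x)^-1.
  rewrite -[a *: (k y - k x : R^o)]/(a * (k y - k x)).
  rewrite -scalerA [k x *: (a *: _)]scalerA [k x * a]mulrC -scalerA -scalerDr.
  by rewrite scalerBl [k x *: (_ - _)]scalerBr subrKA.
by apply: cvgD; [exact: cvgZ | apply: cvgZ => //; exact: cvg_cst].
Qed.

Lemma has_deriv_withinM D (k f : R -> R) x m l :
  has_deriv_within D (k : R -> R^o) x m -> has_deriv_within D (f : R -> R^o) x l ->
  has_deriv_within D ((fun y => k y * f y) : R -> R^o) x (m * f x + k x * l).
Proof. exact: has_deriv_withinZ. Qed.

Lemma has_deriv_within_coord n D (f : R -> 'rV[R]_n) x l i :
  has_deriv_within D f x l ->
  has_deriv_within D ((fun y => f y 0 i) : R -> R^o) x (l 0 i).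
Proof.
move=> fl; rewrite /has_deriv_within.
have := cvg_comp _ _ fl (@coord_continuous R 1 n 0 i l).
by apply: cvg_trans; apply: near_eq_cvg; near=> y; rewrite /= !mxE.
Unshelve. all: by end_near. Qed.

Arguments has_deriv_within_coord {n D f x l} i _.

Lemma has_deriv_within_interior D (f : R -> R) x l :
  nbhs x D -> has_deriv_within D (f : R -> R^o) x l -> is_derive x 1 f l.
Proof.
move=> nD fl.
have {fl} fl : (fun y => (y - x)^-1 *: (f y - f x : R^o)) @ x^' --> l.
  apply: cvg_trans fl; apply: cvg_app => P PD.
  by move: (PD : nbhs x _); apply: filterS2 nD => y /= Dy H yNx; exact: H.
have fl0 : (fun h => h^-1 *: ((f \o shift x) (h *: 1) - f x : R^o)) @ 0^' --> l.
  move=> A /fl; rewrite /dnbhs/within/= => -[e /= e0 H]; exists e => //= h.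
  rewrite /ball/= sub0r normrN => he h0; rewrite /= [h *: 1]mulr1.
  have := H (h + x); rewrite /= /ball/= opprD addrCA subrr addr0 normrN addrK.
  by apply => //; rewrite -subr_eq0 addrK.
by apply: DeriveDef; [apply/cvg_ex; exists l | exact/cvg_lim].
Unshelve. all: by end_near. Qed.

Lemma mean_value_within D (f f' : R -> R) a b : is_interval D -> D a -> D b ->
  a < b -> (forall x, D x -> has_deriv_within D (f : R -> R^o) x (f' x)) ->
  exists2 c, a < c < b & f b - f a = f' c * (b - a).
Proof.
move=> iD Da Db ab ff'.
have sD : `[a, b] `<=` D by move=> z; rewrite /= in_itv/= => /iD; exact.
have [||c] := @MVT R f f' a b ab.
- move=> x xab; apply: (@has_deriv_within_interior D).
    have := near_in_itv xab; apply: filterS => z; rewrite in_itv/= => /andP[az zb].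
    by apply: sD; rewrite /= in_itv/= !ltW.
  apply/ff'/sD; move: xab; rewrite /= !in_itv/= => /andP[az zb].
  by rewrite !ltW.
- apply/subspace_continuousP => x /sD/ff'/has_deriv_within_cts.
  by apply: cvg_trans; apply: cvg_app; exact: within_subset.
- by rewrite in_itv/=; exists c.
Qed.

(** The unordered form of the mean value theorem: a bound on the distance from
[c] to [a] is all that a continuity argument at [a] needs, whichever side [b]
lies on. *)
Lemma mean_value_between D (f f' : R -> R) a b : is_interval D -> D a -> D b ->
  (forall x, D x -> has_deriv_within D (f : R -> R^o) x (f' x)) ->
  exists c, [/\ D c, `|c - a| <= `|b - a| & f b - f a = f' c * (b - a)].
Proof.
move=> iD Da Db ff'.
have [ab|ba|<-] := ltgtP a b; last by exists a; rewrite !subrr normr0 mulr0.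
- have [c /andP[ac cb] E] := mean_value_within iD Da Db ab ff'.
  exists c; split=> //; first by apply: (iD a b) => //; rewrite !ltW.
  by rewrite !gtr0_norm ?subr_gt0 ?lerD2r ?ltW.
- have [c /andP[bc ca] E] := mean_value_within iD Db Da ba ff'.
  exists c; split=> //; first by apply: (iD b a) => //; rewrite !ltW.
    by rewrite !ltr0_norm ?subr_lt0// lerN2 lerD2r ltW.
  by rewrite -[LHS]opprB E -mulrN opprB.
Qed.

Lemma deriv_eq0_const D (f : R -> R) a b : is_interval D -> D a -> D b ->
  (forall x, D x -> has_deriv_within D (f : R -> R^o) x 0) -> f a = f b.
Proof.
move=> iD Da Db f0; have [c [_ _ /eqP]] := mean_value_between iD Da Db f0.
by rewrite mul0r subr_eq0 => /eqP.
Qed.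

End WithinDerivative.

Arguments has_deriv_within_coord {R n D f x l} i _.

(** * Exchange of mixed partial derivatives *)

Section MixedPartials.
Variable R : realType.

(** Schwarz's theorem under the asymmetric hypothesis that only one mixed
derivative is known to exist. The mean value theorem, applied in [s] and then in
[t], turns the second difference of [f] into [(r - s) (t' - t)] times the
value of the mixed derivative at an intermediate point; dividing by [t' - t]
and letting [t'] tend to [t] leaves an increment of [ft] in [s], controlled by
continuity. *)
Lemma mixed_partials_swap (I J : set R) (f ft fs fs_t : R -> R -> R) t t1 s :
  is_interval I -> is_interval J -> I t -> I t1 -> t1 != t -> J s ->
  (forall t s, I t -> J s -> has_deriv_within J (f t : R -> R^o) s (fs t s)) ->
  (forall t s, I t -> J s ->
     has_deriv_within I ((fun t => f t s) : R -> R^o) t (ft t s)) ->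
  (forall t s, I t -> J s ->
     has_deriv_within I ((fun t => fs t s) : R -> R^o) t (fs_t t s)) ->
  {within I `*` J, continuous (fun p : R * R => fs_t p.1 p.2)} ->
  has_deriv_within J (ft t : R -> R^o) s (fs_t t s).
Proof.
move=> iI iJ It It1 t1t Js dfs dft dfst /subspace_continuousP cf.
have PF := within_dnbhs_proper iI It It1 t1t.
have {}cf := cf (t, s) (conj It Js).
apply/cvgrPdist_le => e e0.
have /cvgrPdist_le/(_ e e0) := cf => -[[/= U V] [/= Ut Vs] UV].
have [d d0 dV] := Vs; have [d' d'0 dU] := Ut.
have close t' s' : I t' -> J s' -> `|t' - t| < d' -> `|s' - s| < d ->
    `|fs_t t s - fs_t t' s'| <= e.
  move=> It' Js' t't s's; apply: (UV (t', s')) => //=.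
  by split => /=; [apply: dU|apply: dV]; rewrite /ball/= distrC.
exists d => //= r; rewrite /ball/= => rs rNs Jr.
have rsn : 0 < `|r - s| by rewrite normr_gt0 subr_eq0.
have lim : (t' - t)^-1 * (f t' r - f t r) - (t' - t)^-1 * (f t' s - f t s)
    @[t' --> within I t^'] --> ft t r - ft t s.
  by apply: cvgB; [exact: (dft t r) | exact: (dft t s)].
have bound : \forall t' \near within I t^',
    `|(t' - t)^-1 * (f t' r - f t r) - (t' - t)^-1 * (f t' s - f t s)
      - (r - s) * fs_t t s| <= e * `|r - s|.
  exists d' => //= t'; rewrite /ball/= distrC => t't t'Nt It'.
  (* the intermediate point (c', c) is no farther from (t, s) than (t', r) *)
  have [c [Jc cs Ec]] := @mean_value_between R J (fun y => f t' y - f t y)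
    (fun y => fs t' y - fs t y) s r iJ Js Jr (fun y Jy =>
       has_deriv_withinB (dfs t' y It' Jy) (dfs t y It Jy)).
  have [c' [Ic' c't Ec']] := @mean_value_between R I (fun x => fs x c)
    (fun x => fs_t x c) t t' iI It It' (fun x Ix => dfst x c Ix Jc).
  have -> : (t' - t)^-1 * (f t' r - f t r) - (t' - t)^-1 * (f t' s - f t s)
      = (r - s) * fs_t c' c.
    by rewrite -mulrBr Ec Ec' [_ * (t' - t)]mulrC -mulrA mulKf ?subr_eq0// mulrC.
  rewrite -mulrBr normrM mulrC ler_wpM2r// distrC close//.
    exact: le_lt_trans t't.
  by rewrite (le_lt_trans cs)// distrC.
have lim2 : `|ft t r - ft t s - (r - s) * fs_t t s| <= e * `|r - s|.
  apply: (@cvgr_to_le _ _ PF _ _ _ _ _ bound).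
  by apply: cvg_norm; apply: cvgB => //; exact: cvg_cst.
rewrite -(ler_pM2r rsn) -normrM mulrBl mulrC distrC; apply: le_trans lim2.
rewrite [_ *: _]mulrC mulfVK ?subr_eq0//.
Qed.

End MixedPartials.

(** * Functions that are concave where they are negative *)

Section Concavity.
Variable R : realType.

(** Reflection turns statements about the right end of an interval into
statements about its left end. *)
Lemma has_deriv_within_reflect (D : set R) (f : R -> R) x l :
  has_deriv_within D (f : R -> R^o) (- x) l ->
  has_deriv_within [set y | D (- y)] ((fun y => f (- y)) : R -> R^o) x (- l).
Proof.
move=> fl; rewrite /has_deriv_within.
have -> : (fun y => (y - x)^-1 *: (f (- y) - f (- x) : R^o)) =
    (fun y => - ((- y - - x)^-1 *: (f (- y) - f (- x) : R^o))).
  by apply/funext => y; rewrite -[- y - - x]opprD invrN scaleNr opprK.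
apply: cvgN.
have opp_cvg : - y @[y --> within [set y | D (- y)] x^'] --> within D (- x)^'.
  move=> A HA; have := @opp_continuous R x _ (HA : nbhs (- x) _).
  rewrite /= => H; apply: (filterS _ (H : nbhs x _)) => y /= HAy yx Dy.
  by apply: HAy => //; rewrite eqr_opp.
exact: (cvg_comp _ _ opp_cvg fl).
Qed.

Lemma deriv_le0_nonincreasing (f f' : R -> R) a b : a <= b ->
  (forall x, a <= x <= b ->
    has_deriv_within `[a, b] (f : R -> R^o) x (f' x) /\ f' x <= 0) ->
  f b <= f a.
Proof.
rewrite le_eqVlt => /orP[/eqP-> //|ab] ff'.
have [||||c /andP[ac cb] E] := @mean_value_within R `[a, b] f f' a b _ _ _ ab.
- exact: interval_is_interval.
- by rewrite /= in_itv/= lexx ltW.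
- by rewrite /= in_itv/= lexx ltW.
- by move=> x; rewrite /= in_itv/= => /ff'[].
have [|_ fc] := ff' c; first by rewrite !ltW.
by rewrite -subr_le0 E mulr_le0_ge0// subr_ge0 ltW.
Qed.

Lemma first_nonneg (u : R -> R) a b r : a <= r <= b ->
  (forall x, a <= x <= b -> u y @[y --> within `[a, b] (nbhs x)] --> u x) ->
  0 <= u r ->
  exists d, [/\ a <= d <= b, 0 <= u d & forall x, a <= x < d -> u x < 0].
Proof.
move=> rab cu ur; pose S := [set x | a <= x <= b /\ 0 <= u x].
have Sr : S r by [].
have lS : has_lbound S by exists a => x [/andP[]].
have iS : has_inf S by split; [exists r|].
have ad : a <= inf S by apply: lb_le_inf; [exists r | move=> x [/andP[]]].
have db : inf S <= b.
  by case/andP: (rab) => _; apply: le_trans; exact: ge_inf.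
exists (inf S); split; first by rewrite ad.
- rewrite leNgt; apply/negP => ud.
  have dab : a <= inf S <= b by rewrite ad.
  have /cvgrPdist_lt/(_ (- u (inf S))) := cu _ dab.
  rewrite oppr_gt0 => /(_ ud) [e /= e0 He].
  have [x [xab ux] xe] := inf_adherent e0 iS.
  have dx : inf S <= x by exact: ge_inf.
  have := He x; rewrite /= in_itv/= distrC ger0_norm ?subr_ge0// ltrBlDl.
  move=> /(_ xe xab); rewrite ltNge => /negP; apply.
  by rewrite distrC (le_trans _ (ler_norm _))// lerDr.
- move=> x /andP[ax xd]; rewrite ltNge; apply/negP => ux.
  have : inf S <= x.
    by apply: ge_inf => //; split => //; rewrite ax (le_trans (ltW xd)).
  by rewrite leNgt xd.
Qed.

(** If [u] returns to a nonnegative value to the right of [s], then up to the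
first such point [u] is concave and rises, so its slope at [s] is positive. If
it never returns, [u] is concave all the way to [b], and the slope at [s] is at
least the slope at [b]. *)
Lemma concave_right (u u' u'' : R -> R) a b s :
  (forall x, a <= x <= b -> has_deriv_within `[a, b] (u : R -> R^o) x (u' x)) ->
  (forall x, a <= x <= b -> has_deriv_within `[a, b] (u' : R -> R^o) x (u'' x)) ->
  (forall x, a <= x <= b -> u x < 0 -> u'' x <= 0) ->
  0 <= u b \/ 0 <= u' b ->
  a <= s <= b -> u s < 0 ->
  0 < u' s \/ 0 <= u' s /\ forall x, s <= x <= b -> u x < 0.
Proof.
move=> uu' u'u'' u''0 ub /andP[as_ sb] us.
have sab x : s <= x <= b -> a <= x <= b.
  by case/andP => sx xb; rewrite (le_trans as_)//.
have dec c : s <= c <= b -> (forall x, s <= x <= c -> u x < 0) -> u' c <= u' s.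
  move=> /andP[sc cb] un; apply: (@deriv_le0_nonincreasing _ u'') => // x sxc.
  have xab : a <= x <= b.
    by apply: sab; case/andP: sxc => -> /le_trans; exact.
  split; last exact/u''0/un.
  apply: has_deriv_withinS (u'u'' _ xab) => z; rewrite /= !in_itv/= => /andP[sz zc].
  by rewrite (le_trans as_)//= (le_trans zc).
have [[r [rsb ur]]|nr] := pselect (exists r, s <= r <= b /\ 0 <= u r).
  left; have [|d [/andP[sd db] ud un]] := first_nonneg rsb _ ur.
    move=> x /sab/uu'/has_deriv_within_cts.
    apply: cvg_trans; apply: cvg_app; apply: within_subset => z.
    by rewrite /= !in_itv/= => /sab.
  have {}sd : s < d.
    by rewrite lt_neqAle sd andbT; apply: contraTneq ud => <-; rewrite -ltNge.
  have [||||c /andP[sc cd] E] := @mean_value_within R `[a, b] u u' s d _ _ _ sd.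
  - exact: interval_is_interval.
  - by rewrite /= in_itv/= as_.
  - by rewrite /= in_itv/= db (le_trans as_)// ltW.
  - by move=> x; rewrite /= in_itv/= => /uu'.
  have uc : 0 < u' c.
    rewrite -(pmulr_lgt0 _ (_ : 0 < d - s)) ?subr_gt0//.
    by rewrite -E subr_gt0 (lt_le_trans us).
  apply: lt_le_trans uc _; apply: dec => [|x /andP[sx xc]].
    by rewrite ltW//= (le_trans (ltW cd)).
  by apply: un; rewrite sx (le_lt_trans xc).
have un x : s <= x <= b -> u x < 0.
  by move=> xsb; rewrite ltNge; apply/negP => ux; apply: nr; exists x.
right; split=> //.
case: ub => [ub|/le_trans]; last by apply; apply: dec; rewrite ?lexx ?sb.
by have := un b; rewrite lexx sb ltNge ub => /(_ isT).
Qed.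

Lemma concave_left (u u' u'' : R -> R) a b s :
  (forall x, a <= x <= b -> has_deriv_within `[a, b] (u : R -> R^o) x (u' x)) ->
  (forall x, a <= x <= b -> has_deriv_within `[a, b] (u' : R -> R^o) x (u'' x)) ->
  (forall x, a <= x <= b -> u x < 0 -> u'' x <= 0) ->
  0 <= u a \/ u' a <= 0 ->
  a <= s <= b -> u s < 0 ->
  u' s < 0 \/ u' s <= 0 /\ forall x, a <= x <= s -> u x < 0.
Proof.
move=> uu' u'u'' u''0 ua sab us.
have itvN x : (- b <= x <= - a) = (a <= - x <= b).
  by rewrite lerNl lerNr andbC.
have setN : `[- b, - a]%classic = [set y : R | `[a, b]%classic (- y)].
  by apply/seteqP; split => x; rewrite /= !in_itv/= itvN.
have := @concave_right (fun x => u (- x)) (fun x => - u' (- x)) (fun x => u'' (- x))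
  (- b) (- a) (- s).
rewrite setN !opprK oppr_gt0 !oppr_ge0 itvN opprK; case => //.
- by move=> x; rewrite itvN => xab; apply/has_deriv_within_reflect/uu'.
- move=> x; rewrite itvN => xab; rewrite -[u'' _]opprK.
  have := has_deriv_within_reflect (u'u'' _ xab); rewrite /has_deriv_within.
  move=> /cvgN; apply: cvg_trans; apply: near_eq_cvg; near=> y.
  by rewrite /= -opprD scalerN.
- by move=> x; rewrite itvN; exact: u''0.
- by left.
- case=> u'0 un; right; split => // x /andP[ax xs].
  by rewrite -(opprK x); apply: un; rewrite !lerN2 ax xs.
Unshelve. all: by end_near. Qed.

(** At a point where [u] is negative, the information from the right end makes
the slope nonnegative and that from the left end makes it nonpositive; the
strict alternatives would contradict this, so [u] stays negative up to both
ends and its slope is zero throughout. *)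
Lemma nonneg_or_negative_constant (u u' u'' : R -> R) a b :
  (forall x, a <= x <= b -> has_deriv_within `[a, b] (u : R -> R^o) x (u' x)) ->
  (forall x, a <= x <= b -> has_deriv_within `[a, b] (u' : R -> R^o) x (u'' x)) ->
  (forall x, a <= x <= b -> u x < 0 -> u'' x <= 0) ->
  0 <= u a \/ u' a <= 0 -> 0 <= u b \/ 0 <= u' b ->
  (forall x, a <= x <= b -> 0 <= u x) \/
  (forall x, a <= x <= b -> u x < 0 /\ u' x = 0).
Proof.
move=> uu' u'u'' u''0 ua ub.
have rgt := concave_right uu' u'u'' u''0 ub.
have lft := concave_left uu' u'u'' u''0 ua.
have [[s [sab us]]|ns] := pselect (exists s, a <= s <= b /\ u s < 0); last first.
  left=> x xab; rewrite leNgt; apply/negP => ux; apply: ns; by exists x.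
right.
have un x : a <= x <= b -> u x < 0.
  move=> /andP[ax xb]; case: (rgt _ sab us) => [p|[p Hr]];
    case: (lft _ sab us) => [n|[n Hl]].
  - by have := lt_trans p n; rewrite ltxx.
  - by have := lt_le_trans p n; rewrite ltxx.
  - by have := le_lt_trans p n; rewrite ltxx.
  - by have [xs|/ltW sx] := leP x s; [apply: Hl | apply: Hr]; apply/andP.
move=> x xab; split; first exact: un.
have ux := un x xab; apply/eqP; rewrite eq_le.
by case: (rgt _ xab ux) => [/ltW ->|[-> _]]; case: (lft _ xab ux) => [/ltW ->|[-> _]].
Qed.

End Concavity.

(** * Euclidean scalar product *)

Section DotProduct.
Variable R : realType.
Implicit Types u v w : 'rV[R]_3.

Definition dot u v : R := \sum_(i < 3) u 0 i * v 0 i.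

Lemma dotC u v : dot u v = dot v u.
Proof. by apply: eq_bigr => i _; rewrite mulrC. Qed.

Lemma dotDl u v w : dot (u + v) w = dot u w + dot v w.
Proof. by rewrite -big_split; apply: eq_bigr => i _; rewrite mxE mulrDl. Qed.

Lemma dotZl (k : R) u v : dot (k *: u) v = k * dot u v.
Proof. by rewrite mulr_sumr; apply: eq_bigr => i _; rewrite mxE mulrA. Qed.

Lemma dot0l v : dot 0 v = 0.
Proof. by rewrite /dot big1// => i _; rewrite mxE mul0r. Qed.

Lemma dot_ge0 u : 0 <= dot u u.
Proof. by apply: sumr_ge0 => i _; rewrite -expr2 sqr_ge0. Qed.

Lemma dot_eq0 u : dot u u = 0 -> u = 0.
Proof.
move=> /eqP; rewrite psumr_eq0; last by move=> i _; rewrite -expr2 sqr_ge0.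
move=> /allP u0; apply/rowP => i; have := u0 i (mem_index_enum _).
by rewrite mxE -expr2 sqrf_eq0 => /eqP.
Qed.

Lemma enormE u : enorm u = Num.sqrt (dot u u).
Proof. by congr Num.sqrt; apply: eq_bigr => i _; rewrite expr2. Qed.

Lemma enorm_eq1 u : enorm u = 1 -> dot u u = 1.
Proof. by rewrite enormE => u1; rewrite -(sqr_sqrtr (dot_ge0 u)) u1 expr1n. Qed.

Lemma enorm0 : enorm (0 : 'rV[R]_3) = 0.
Proof. by rewrite enormE dot0l sqrtr0. Qed.

Lemma enormN u : enorm (- u) = enorm u.
Proof. by congr Num.sqrt; apply: eq_bigr => i _; rewrite mxE sqrrN. Qed.

Lemma has_deriv_within_dot (D : set R) (u v : R -> 'rV[R]_3) x u' v' :
  (forall i, has_deriv_within D ((fun y => u y 0 i) : R -> R^o) x (u' 0 i)) ->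
  (forall i, has_deriv_within D ((fun y => v y 0 i) : R -> R^o) x (v' 0 i)) ->
  has_deriv_within D ((fun y => dot (u y) (v y)) : R -> R^o) x
    (dot u' (v x) + dot (u x) v').
Proof.
move=> uu' vv'; rewrite /dot -big_split.
have := @has_deriv_within_sum R R^o D _ (index_enum 'I_3) (fun i y => u y 0 i * v y 0 i) x
   (fun i => u' 0 i * v x 0 i + u x 0 i * v' 0 i).
by apply => i; exact: has_deriv_withinM.
Qed.

End DotProduct.

(** * The tension equation *)

Section String.
Variables (R : realType) (I J : set R) (g : 'rV[R]_3).
Variables (eta : R -> R -> 'rV[R]_3) (sigma : R -> R -> R).
Variables (t0 t1 s0 s1 : R).
(* Two distinct points in each interval make the one-sided derivatives unique,
   so that derivatives of equal functions can be compared. *)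
Hypotheses (iI : is_interval I) (iJ : is_interval J).
Hypotheses (It0 : I t0) (It1 : I t1) (t01 : t0 != t1).
Hypotheses (Js0 : J s0) (Js1 : J s1) (s01 : s0 != s1).
Hypotheses (hreg : regular I J eta sigma).
Hypotheses (heq : string_equations I J g eta sigma).

Local Notation eta_s := (ps J eta).
Local Notation eta_ss := (ps J (ps J eta)).
Local Notation eta_t := (pt I eta).
Local Notation eta_tt := (pt I (pt I eta)).
Local Notation eta_st := (pt I (ps J eta)).
Local Notation eta_stt := (pt I (pt I (ps J eta))).
Local Notation sigma_s := (ps J (sigma : R -> R -> R^o)).
Local Notation sigma_ss := (ps J (ps J (sigma : R -> R -> R^o))).

Lemma another_point (D : set R) x y z : D x -> D y -> x != y ->
  exists2 w, D w & w != z.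
Proof.
move=> Dx Dy xy; have [xz|xz] := eqVneq x z; last by exists x.
by exists y => //; rewrite -xz eq_sym.
Qed.

Lemma ptP (V : normedModType R) (f : R -> R -> V) t s :
  has_cont_pt I J f -> I t -> J s ->
  has_deriv_within I (fun t => f t s) t (pt I f t s).
Proof. by move=> [df _] It Js; exact: df. Qed.

Lemma psP (V : normedModType R) (f : R -> R -> V) t s :
  has_cont_ps I J f -> I t -> J s -> has_deriv_within J (f t) s (ps J f t s).
Proof. by move=> [df _] It Js; exact: df. Qed.

Lemma pt_uniqueE (V : normedModType R) (f : R -> R -> V) t s l : I t ->
  has_deriv_within I (fun t => f t s) t l -> pt I f t s = l.
Proof.
move=> It; have [w Iw wt] := another_point t It0 It1 t01.
exact: has_deriv_withinE wt.
Qed.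

Lemma ps_uniqueE (V : normedModType R) (f : R -> R -> V) t s l : J s ->
  has_deriv_within J (f t) s l -> ps J f t s = l.
Proof.
move=> Js; have [w Jw ws] := another_point s Js0 Js1 s01.
exact: has_deriv_withinE ws.
Qed.

Lemma within_continuous_coord (f : R -> R -> 'rV[R]_3) i :
  {within I `*` J, continuous (fun p : R * R => f p.1 p.2)} ->
  {within I `*` J, continuous (fun p : R * R => f p.1 p.2 0 i)}.
Proof.
move=> /subspace_continuousP cf; apply/subspace_continuousP => p Dp.
exact: (cvg_comp _ _ (cf p Dp) (@coord_continuous R 1 3 0 i _)).
Qed.

Lemma deriv_eta_t t s i : I t -> J s ->
  has_deriv_within J ((fun s => eta_t t s 0 i) : R -> R^o) s (eta_st t s 0 i).
Proof.
case: hreg => -[h1 h2 _ h4] _ It Js.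
have [w Iw wt] := another_point t It0 It1 t01.
apply: (@mixed_partials_swap R I J (fun t s => eta t s 0 i)
  (fun t s => eta_t t s 0 i) (fun t s => eta_s t s 0 i)
  (fun t s => eta_st t s 0 i) t w s) => //.
- by move=> *; apply: has_deriv_within_coord; exact: psP.
- by move=> t' s' It' Js'; have := has_deriv_within_coord i (ptP h1 It' Js').
- by move=> t' s' It' Js'; have := has_deriv_within_coord i (ptP h4 It' Js').
- by apply: within_continuous_coord; case: h4.
Qed.

Lemma deriv_eta_tt t s i : I t -> J s ->
  has_deriv_within J ((fun s => eta_tt t s 0 i) : R -> R^o) s (eta_stt t s 0 i).
Proof.
case: hreg => -[_ _ _ h4] [h5 h6 _ _] It Js.
have [w Iw wt] := another_point t It0 It1 t01.
apply: (@mixed_partials_swap R I J (fun t s => eta_t t s 0 i)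
  (fun t s => eta_tt t s 0 i) (fun t s => eta_st t s 0 i)
  (fun t s => eta_stt t s 0 i) t w s) => //.
- by move=> *; exact: deriv_eta_t.
- by move=> t' s' It' Js'; have := has_deriv_within_coord i (ptP h5 It' Js').
- by move=> t' s' It' Js'; have := has_deriv_within_coord i (ptP h6 It' Js').
- by apply: within_continuous_coord; case: h6.
Qed.

Arguments deriv_eta_tt {t s} i _ _.

Lemma eta_s_unit t s : I t -> J s -> dot (eta_s t s) (eta_s t s) = 1.
Proof. by move=> It Js; apply: enorm_eq1; exact: (heq It Js).2. Qed.

Lemma deriv_eta_s t s i (h : has_cont_ps I J eta_s) : I t -> J s ->
  has_deriv_within J ((fun s => eta_s t s 0 i) : R -> R^o) s (eta_ss t s 0 i).
Proof. by move=> It Js; have := has_deriv_within_coord i (psP h It Js). Qed.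

Arguments deriv_eta_s {t s} i _ _ _.

Lemma eta_s_ss t s : I t -> J s -> dot (eta_s t s) (eta_ss t s) = 0.
Proof.
case: hreg => -[_ _ h3 _] _ It Js.
have [w Jw ws] := another_point s Js0 Js1 s01.
have d2 := has_deriv_within_dot (fun i => deriv_eta_s i h3 It Js)
  (fun i => deriv_eta_s i h3 It Js).
have /(has_deriv_within_unique iJ Js Jw ws d2) :
    has_deriv_within J ((fun y => dot (eta_s t y) (eta_s t y)) : R -> R^o) s 0.
  apply: (@eq_has_deriv_within R R^o J (fun=> 1)) => //.
    by move=> y Jy; rewrite eta_s_unit.
  exact: has_deriv_within_cst.
by rewrite dotC => /eqP; rewrite -mulr2n mulrn_eq0/= => /eqP.
Qed.

Lemma eta_s_st t s : I t -> J s -> dot (eta_s t s) (eta_st t s) = 0.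
Proof.
case: hreg => -[_ _ _ h4] _ It Js.
have [w Iw wt] := another_point t It0 It1 t01.
have c i := has_deriv_within_coord i (ptP h4 It Js).
have d2 := has_deriv_within_dot c c.
have /(has_deriv_within_unique iI It Iw wt d2) :
    has_deriv_within I ((fun y => dot (eta_s y s) (eta_s y s)) : R -> R^o) t 0.
  apply: (@eq_has_deriv_within R R^o I (fun=> 1)) => //.
    by move=> y Iy; rewrite eta_s_unit.
  exact: has_deriv_within_cst.
by rewrite dotC => /eqP; rewrite -mulr2n mulrn_eq0/= => /eqP.
Qed.

(** Differentiate [eta_s . eta_st = 0] once more in [t]. *)
Lemma eta_s_stt t s : I t -> J s ->
  dot (eta_stt t s) (eta_s t s) = - dot (eta_st t s) (eta_st t s).
Proof.
case: hreg => -[_ _ _ h4] [_ h6 _ _] It Js.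
have [w Iw wt] := another_point t It0 It1 t01.
have c i := has_deriv_within_coord i (ptP h4 It Js).
have c2 i := has_deriv_within_coord i (ptP h6 It Js).
have d2 := has_deriv_within_dot c c2.
have /(has_deriv_within_unique iI It Iw wt d2) :
    has_deriv_within I ((fun y => dot (eta_s y s) (eta_st y s)) : R -> R^o) t 0.
  apply: (@eq_has_deriv_within R R^o I (fun=> 0)) => //.
    by move=> y Iy; rewrite eta_s_st.
  exact: has_deriv_within_cst.
by rewrite addrC => /eqP; rewrite addr_eq0 dotC => /eqP.
Qed.

Lemma eta_ttE t s : I t -> J s ->
  eta_tt t s = sigma_s t s *: eta_s t s + sigma t s *: eta_ss t s + g.
Proof.
case: hreg => -[_ _ h3 _] [_ _ h7 _] It Js; rewrite (heq It Js).1; congr (_ + g).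
apply: ps_uniqueE => //.
by apply: has_deriv_withinZ; [exact: (psP h7) | exact: (psP h3)].
Qed.

Lemma tangential_acceleration t s : I t -> J s ->
  dot (eta_tt t s) (eta_s t s) = sigma_s t s + dot g (eta_s t s).
Proof.
move=> It Js; rewrite eta_ttE// !dotDl !dotZl eta_s_unit// [dot (eta_ss _ _) _]dotC.
by rewrite eta_s_ss// mulr0 addr0 mulr1.
Qed.

(** The [s]-derivative of [tangential_acceleration], computed on both sides:
[eta_stt . eta_s + eta_tt . eta_ss = sigma_ss + g . eta_ss]. Inserting the
equation of motion in [eta_tt . eta_ss] cancels [g]. *)
Lemma tension_equation t s : I t -> J s ->
  sigma_ss t s = sigma t s * dot (eta_ss t s) (eta_ss t s)
                 - dot (eta_st t s) (eta_st t s).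
Proof.
case: hreg => -[_ _ h3 _] [_ _ _ h8] It Js.
have [w Jw ws] := another_point s Js0 Js1 s01.
have c i := deriv_eta_s i h3 It Js.
have d1 := has_deriv_within_dot (fun i => deriv_eta_tt i It Js) c.
have d2 : has_deriv_within J ((fun y => dot (eta_tt t y) (eta_s t y)) : R -> R^o) s
    (sigma_ss t s + dot g (eta_ss t s)).
  apply: (@eq_has_deriv_within R R^o J (fun y => sigma_s t y + dot g (eta_s t y))) => //.
    by move=> y Jy; rewrite tangential_acceleration.
  apply: has_deriv_withinD; first exact: (psP h8).
  rewrite -[dot g _](add0r (_ : R)) -(dot0l (eta_s t s)).
  apply: (@has_deriv_within_dot R J (fun=> g)) => // i.
  by rewrite mxE; exact: has_deriv_within_cst.
move: (has_deriv_within_unique iJ Js Jw ws d1 d2).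
move: (eta_s_stt It Js) (eta_s_ss It Js) (eta_ttE It Js).
(* From here on only linear algebra in the values at (t, s) is involved. *)
move: (eta_stt t s) (eta_tt t s) (eta_ss t s) (eta_st t s) (eta_s t s).
move: (sigma_ss t s) (sigma_s t s) (sigma t s).
move=> k2 k1 k vstt vtt vss vst vs -> sss ->.
rewrite !dotDl !dotZl sss mulr0 add0r addrA.
by move/addIr; rewrite addrC => ->.
Qed.

(** A point of the string that never moves has no acceleration, so the tangential
equation loses its left-hand side there. *)
Lemma sigma_s_at_fixed_point t s p : g = 0 -> I t -> J s ->
  (forall t', I t' -> eta t' s = p) -> sigma_s t s = 0.
Proof.
move=> g0 It Js etap.
have eta_t0 t' : I t' -> eta_t t' s = 0.
  move=> It'; apply: pt_uniqueE => //.
  apply: (@eq_has_deriv_within R _ I (fun=> p)) => //.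
    by move=> y Iy; rewrite etap.
  exact: has_deriv_within_cst.
have eta_tt0 : eta_tt t s = 0.
  apply: pt_uniqueE => //.
  apply: (@eq_has_deriv_within R _ I (fun=> 0)) => //.
    by move=> y Iy; rewrite eta_t0.
  exact: has_deriv_within_cst.
have := tangential_acceleration It Js.
by rewrite eta_tt0 g0 !dot0l addr0.
Qed.

(** The tension equation shows that [sigma] is concave where it is negative, and
that in the exceptional case of a constant negative tension the curvature
[eta_ss] vanishes. *)
Lemma nonneg_or_straight t a b : I t -> a < b -> J a -> J b ->
  0 <= sigma t a \/ sigma_s t a <= 0 -> 0 <= sigma t b \/ 0 <= sigma_s t b ->
  (forall s, a <= s <= b -> 0 <= sigma t s) \/
  (sigma t a < 0 /\ eta t b - eta t a = (b - a) *: eta_s t a).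
Proof.
move=> It ab Ja Jb sa sb; case: hreg => -[_ h2 h3 _] [_ _ h7 h8].
have Jab x : a <= x <= b -> J x by exact: iJ.
have sJ : `[a, b] `<=` J by move=> x; rewrite /= in_itv/=; exact: Jab.
have aa : a <= a <= b by rewrite lexx ltW.
have bb : a <= b <= b by rewrite lexx ltW.
have dsig x : a <= x <= b ->
    has_deriv_within `[a, b] (sigma t : R -> R^o) x (sigma_s t x).
  by move=> /Jab Jx; apply: has_deriv_withinS sJ _; exact: (psP h7).
have dsig_s x : a <= x <= b ->
    has_deriv_within `[a, b] (sigma_s t : R -> R^o) x (sigma_ss t x).
  by move=> /Jab Jx; apply: has_deriv_withinS sJ _; exact: (psP h8).
have sig_ss x : a <= x <= b -> sigma t x < 0 -> sigma_ss t x <= 0.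
  move=> /Jab Jx sx; rewrite tension_equation// subr_le0.
  by rewrite (le_trans _ (dot_ge0 _))// mulr_le0_ge0 ?dot_ge0 ?ltW.
have [|neg] := nonneg_or_negative_constant dsig dsig_s sig_ss sa sb; first by left.
right; split; first exact: (neg a aa).1.
have iab : is_interval `[a, b]%classic by exact: interval_is_interval.
have ss0 x : a <= x <= b -> sigma_ss t x = 0.
  move=> xab.
  have [w Iw wx] : exists2 w, `[a, b]%classic w & w != x.
    by apply: (@another_point _ a b) => //; rewrite /= ?in_itv//= lt_eqF.
  apply: (has_deriv_within_unique iab _ Iw wx (dsig_s x xab)).
    by rewrite /= in_itv.
  apply: (@eq_has_deriv_within R R^o _ (fun=> 0)); last exact: has_deriv_within_cst.
    by move=> y; rewrite /= in_itv/= => /neg[].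
  by rewrite /= in_itv.
have ess0 x : a <= x <= b -> eta_ss t x = 0.
  move=> xab; have [sx _] := neg x xab; apply: dot_eq0.
  apply/eqP; rewrite eq_le dot_ge0 andbT -(nmulr_rge0 _ sx).
  have /eqP := tension_equation It (Jab x xab).
  by rewrite ss0// eq_sym subr_eq0 => /eqP->; exact: dot_ge0.
have deta_s i x : `[a, b]%classic x ->
    has_deriv_within `[a, b] ((fun x => eta_s t x 0 i) : R -> R^o) x 0.
  rewrite /= in_itv/= => xab.
  have := deriv_eta_s i h3 It (Jab x xab).
  by rewrite ess0// mxE; exact: has_deriv_withinS.
apply/rowP => i; rewrite !mxE.
have [|||c /andP[ac cb] ->] := @mean_value_within R `[a, b] (fun x => eta t x 0 i)
  (fun x => eta_s t x 0 i) a b iab _ _ ab.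
- by rewrite /= in_itv.
- by rewrite /= in_itv.
- move=> x; rewrite /= in_itv/= => xab; apply: (has_deriv_withinS sJ).
  by apply: has_deriv_within_coord; exact: (psP h2 It (Jab x xab)).
rewrite mulrC; congr (_ * _).
apply: (@deriv_eq0_const R `[a, b] (fun x => eta_s t x 0 i)) => //.
  by rewrite /= in_itv/= !ltW.
exact: deta_s.
Qed.

End String.

(** * Minima of periodic functions, and the conclusion *)

Section PeriodicMinimum.
Variable R : realType.

Lemma periodic1_unit_rep (f : R -> R) s : (forall s, f s = f (s + 1)) ->
  exists2 r, r \in `[0, 1] & f r = f s.
Proof.
move=> f1; have fP : periodic f 1 by move=> x; rewrite -f1.
exists (s - (Num.floor s)%:~R).
  have /andP[fs sf] := floor_itv s; rewrite in_itv/= subr_ge0 fs/= lerBlDl.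
  by rewrite ltW// -[1]/(1%:~R) -intrD.
case: (Num.floor s) => n.
  by rewrite -(periodicn fP n) -[1 *+ n]/(n%:R) -pmulrn subrK.
by rewrite NegzE mulrNz opprK -pmulrn; exact: (periodicn fP).
Qed.

Lemma periodic1_min (f : R -> R) : (forall s, f s = f (s + 1)) ->
  {within `[0, 1], continuous f} -> exists m, forall s, f m <= f s.
Proof.
move=> f1 cf; have [m _ mP] := EVT_min ler01 cf.
by exists m => s; have [r r01 <-] := periodic1_unit_rep s f1; exact: mP.
Qed.

Lemma deriv_at_global_min (f f' : R -> R) m :
  (forall s, has_deriv_within setT (f : R -> R^o) s (f' s)) ->
  (forall s, f m <= f s) -> f' m = 0.
Proof.
move=> df mP.
have df' (s : R) : is_derive s 1 f (f' s).
  by apply: (@has_deriv_within_interior R setT) => //; exact: filterT.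
have : is_derive m 1 f 0.
  apply: (@derive1_at_min R f (m - 1) (m + 1)) => //.
  - by rewrite lerD2l -subr_ge0 opprK addr_ge0.
  - by rewrite in_itv/= ltrBlDr !ltrDl ltr01.
by move=> [_ <-]; case: (df' m).
Qed.

End PeriodicMinimum.

Lemma s_domain_interval (R : realType) b : is_interval (s_domain b : set R).
Proof. by case: b => //; exact: interval_is_interval. Qed.

Lemma s_domain01 (R : realType) b s : 0 <= s <= 1 -> (s_domain b : set R) s.
Proof. by case: b => //= s01; rewrite in_itv. Qed.

Unset Implicit Arguments.

Theorem proposition2p1 (R : realType) (T : R) (g : 'rV[R]_3)
    (alpha beta : R -> 'rV[R]_3)
    (eta : R -> R -> 'rV[R]_3) (sigma : R -> R -> R) (b : boundary_type)
    (hT : 0 < T)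
    (hreg : regular `[0, T] (s_domain b) eta sigma)
    (heq : string_equations `[0, T] (s_domain b) g eta sigma)
    (hinit : initial_conditions `[0, T] (s_domain b) alpha beta eta)
    (hbc : boundary_condition b `[0, T] alpha eta sigma)
    (hcase : [\/ b = FreeEnds \/ b = Periodic,
                 b = Whip /\ g = 0 |
                 [/\ b = FixedEnds, enorm (alpha 0 - alpha 1) < 1 & g = 0]]) :
  forall t s, t \in `[0, T] -> s_domain b s -> 0 <= sigma t s.
Proof.
move=> t s It Js.
have {}It : `[0, T]%classic t by [].
have tT : `[0, T]%classic 0 by rewrite /= in_itv/= lexx ltW.
have TT : `[0, T]%classic T by rewrite /= in_itv/= lexx ltW.
have T0 : (0 : R) != T by rewrite lt_eqF.
have iI : is_interval `[0, T]%classic by exact: interval_is_interval.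
have iJ := @s_domain_interval R b.
have J0 : (s_domain b : set R) 0 by apply: s_domain01; rewrite lexx ler01.
have J1 : (s_domain b : set R) 1 by apply: s_domain01; rewrite lexx ler01.
have n01 : (0 : R) != 1 by rewrite eq_sym oner_neq0.
have straight := nonneg_or_straight iI iJ tT TT T0 J0 J1 n01 hreg heq It.
have at_rest := sigma_s_at_fixed_point iI iJ tT TT T0 J0 J1 n01 hreg heq.
have unit := heq t _ It.
have itv01 (x : R) : s_domain b x -> b <> Periodic -> 0 <= x <= 1.
  by case: (b) => //=; rewrite in_itv.
case: hcase => [[bF|bP]|[bW g0]|[bA ends g0]].
- subst; have [s0 s1] := hbc t It.
  have [||pos|[]] := straight 0 1 ltr01 J0 J1.
  - by left; rewrite s0.
  - by left; rewrite s1.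
  - by apply: pos; exact: itv01.
  - by rewrite s0 ltxx.
- subst; have per x : sigma t x = sigma t (x + 1) by case: (hbc t x It).
  have dsig x : has_deriv_within setT (sigma t : R -> R^o) x
      (ps setT (sigma : R -> R -> R^o) t x).
    by case: hreg => _ [_ _ h7 _]; exact: (psP h7).
  have [m mP] : exists m, forall x, sigma t m <= sigma t x.
    apply: periodic1_min per _; apply: continuous_subspaceT => x.
    have := has_deriv_within_cts (dsig x); apply: cvg_trans; apply: cvg_app => A HA.
    by apply: (filterS _ (HA : nbhs x _)) => y; exact.
  (* Both ends of [m, m + 1] are minima, so one period from m has no slope at
     either end. *)
  have m0 := deriv_at_global_min dsig mP.
  have m1 : ps setT (sigma : R -> R -> R^o) t (m + 1) = 0.
    by apply: deriv_at_global_min dsig _ => x; rewrite -per.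
  have mm : m < m + 1 by rewrite ltrDl.
  have [| |pos|[_]] := straight m (m + 1) mm I I.
  - by right; rewrite m0.
  - by right; rewrite m1.
  - by apply: le_trans (mP s); apply: pos; rewrite lexx ltW.
  - case: (hbc t m It) => <- _; rewrite subrr addrAC subrr add0r scale1r => e0.
    have := (unit m I).2; rewrite -e0 enorm0 => /eqP.
    by rewrite eq_sym oner_eq0.
- subst; have [s0 e1] := hbc t It.
  have r1 : ps `[0, 1] (sigma : R -> R -> R^o) t 1 = 0.
    by apply: (at_rest t 1 0) => // t' It'; case: (hbc t' It').
  have [||pos|[]] := straight 0 1 ltr01 J0 J1.
  - by left; rewrite s0.
  - by right; rewrite r1.
  - by apply: pos; exact: itv01.
  - by rewrite s0 ltxx.
- subst; have [e0 e1] := hbc t It.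
  have r0 : ps `[0, 1] (sigma : R -> R -> R^o) t 0 = 0.
    by apply: (at_rest t 0 (alpha 0)) => // t' It'; case: (hbc t' It').
  have r1 : ps `[0, 1] (sigma : R -> R -> R^o) t 1 = 0.
    by apply: (at_rest t 1 (alpha 1)) => // t' It'; case: (hbc t' It').
  have [||pos|[_]] := straight 0 1 ltr01 J0 J1.
  - by right; rewrite r0.
  - by right; rewrite r1.
  - by apply: pos; exact: itv01.
  - rewrite subr0 scale1r e0 e1 => e01; move: ends.
    by rewrite -enormN opprB e01 (unit 0 J0).2 ltxx.
Qed.
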